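(* For every integer $m\ge1$, with $\mathbf x=(x_1,\dots,x_m)$, $$\prod_{i=1}^m(1+x_i)(1-x_i^2)=\sum_{(\lambda'_1,\lambda'_2,\lambda'_3)\trianglelefteq(m^3)}(-1)^{\delta(\lambda'_2\equiv_2 1)}\,\mathsf m^{(m)}_\lambda(\mathbf x)=\sum_{\lambda\trianglelefteq(3^m)}\widetilde\omega_\epsilon(z,b')\,S^{\mathrm{U}(m)}_\lambda(\mathbf x),$$ where in the first sum $\lambda$ is the partition with transpose $\lambda'=(\lambda_1',\lambda_2',\lambda_3')$, and in the second sum, for each $\lambda$, the transpose is written $\lambda'=(a+2k,b+2k,\epsilon+2k)$ with $k\ge0$, $\epsilon\in\{0,1\}$, $a\ge b\ge\epsilon$, and $z:=a-b$, $b':=b-\epsilon$; here $$\widetilde\omega_\epsilon(z,b')=\frac{\alpha_\epsilon(z,b')\cdot(b',z)+\widetilde\beta_\epsilon(z,b')}{2}$$ with $\alpha_\epsilon$ and $\widetilde\beta_\epsilon$ as in the context.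
   Context: $\delta(P)=1$ if $P$ is true and $0$ otherwise; $m\equiv_k m'$ means $k\mid m-m'$. Partitions may have trailing zeros; $\lambda\trianglelefteq\mu$ means containment of Young diagrams; $\lambda'$ is the transpose of $\lambda$; $(g^m)$ is the partition with $m$ parts equal to $g$. $\mathsf m^{(m)}_\lambda$ is the monomial symmetric polynomial and $S^{\mathrm{U}(m)}_\lambda$ the Schur polynomial in $m$ variables. $(x,y)\cdot(b',z)=xb'+yz$. The functions $\alpha_\epsilon(z,b')$, $\widetilde\beta_\epsilon(z,b')$ depend only on $z,b'$ modulo $2$: the value is the entry in row $z\bmod 2$ and column $b'\bmod2$ (numbered from $0$) of $$\alpha_0=\begin{pmatrix}(1,1)&(-1,0)\\(0,1)&(0,0)\end{pmatrix},\quad \alpha_1=\begin{pmatrix}(-1,-1)&(1,0)\\(0,-1)&(0,0)\end{pmatrix},\quad \widetilde\beta_0=\begin{pmatrix}2&-1\\1&0\end{pmatrix},\quad \widetilde\beta_1=\begin{pmatrix}-2&1\\-1&0\end{pmatrix}.$$ *)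

(* Defs.v *)
From HB Require Import structures.
From mathcomp Require Import all_boot all_order all_algebra.
From mathcomp Require Import mpoly.
From mathcomp Require Import zify.

Set Implicit Arguments.
Unset Strict Implicit.
Unset Printing Implicit Defensive.

Import GRing.Theory.
Local Open Scope ring_scope.

(* A partition is a nonincreasing [seq nat], possibly with trailing zeros; its
   i-th part (from 0) is [nth 0 lam i]. *)
Definition is_part (lam : seq nat) : bool := sorted geq lam.

(* The parts of the transpose, i.e. the column lengths; no trailing zeros. *)
Definition conjp (lam : seq nat) : seq nat :=
  [seq count (fun p => (j < p)%N) lam | j <- iota 0 (\max_(p <- lam) p)].

Definition parts (n c : nat) (t : n.-tuple 'I_c.+1) : seq nat :=
  [seq val i | i <- t].

(* The partitions contained in (c^n), each padded by zeros to n parts. *)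
Definition box (n c : nat) : {set n.-tuple 'I_c.+1} :=
  [set t | is_part (parts t)].

(* The sum of all distinct monomials whose exponent vector rearranges lam
   (padded to n parts); it is 0 if lam has more than n nonzero parts. *)
Definition monomial_sym (R : nzRingType) (n : nat) (lam : seq nat) :
    {mpoly R[n]} :=
  if (count (fun p => 0 < p)%N lam <= n)%N then
    \sum_(e <- permutations (mkseq (nth 0%N lam) n))
      'X_[ [multinom nth 0%N e i | i < n] ]
  else 0.

Definition cell (lam : seq nat) : finType :=
  {i : 'I_(size lam) & 'I_(nth 0%N lam i)}.

Definition cell_row (lam : seq nat) (u : cell lam) : nat := tag u.
Definition cell_col (lam : seq nat) (u : cell lam) : nat := tagged u.

Definition is_ssyt (n : nat) (lam : seq nat)
    (T : {ffun cell lam -> 'I_n}) : bool :=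
  [forall u : cell lam, forall v : cell lam,
     ((cell_row u == cell_row v) && (cell_col u < cell_col v)%N
        ==> (T u <= T v)%N)
     && ((cell_col u == cell_col v) && (cell_row u < cell_row v)%N
        ==> (T u < T v)%N)].

Definition schur (R : nzRingType) (n : nat) (lam : seq nat) : {mpoly R[n]} :=
  \sum_(T : {ffun cell lam -> 'I_n} | is_ssyt T) \prod_(u : cell lam) 'X_(T u).

(* Row z mod 2, column b' mod 2. *)
Definition alpha (eps : bool) (z b' : nat) : int * int :=
  match eps, odd z, odd b' with
  | false, false, false => (1, 1)
  | false, false, true  => (-1, 0)
  | false, true,  false => (0, 1)
  | false, true,  true  => (0, 0)
  | true,  false, false => (-1, -1)
  | true,  false, true  => (1, 0)
  | true,  true,  false => (0, -1)
  | true,  true,  true  => (0, 0)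
  end.

Definition betat (eps : bool) (z b' : nat) : int :=
  match eps, odd z, odd b' with
  | false, false, false => 2
  | false, false, true  => -1
  | false, true,  false => 1
  | false, true,  true  => 0
  | true,  false, false => -2
  | true,  false, true  => 1
  | true,  true,  false => -1
  | true,  true,  true  => 0
  end.

Definition dot (p : int * int) (b' z : nat) : int :=
  p.1 * b'%:Z + p.2 * z%:Z.

Definition omegat (eps : bool) (z b' : nat) : rat :=
  (dot (alpha eps z b') b' z + betat eps z b')%:~R / 2%:R.

(* The quadruple (a, b, eps, k) with
   (l1, l2, l3) = (a + 2k, b + 2k, eps + 2k), for l1 >= l2 >= l3. *)
Definition shape_coords (l1 l2 l3 : nat) : nat * nat * bool * nat :=
  let k := l3./2 in ((l1 - k.*2)%N, (l2 - k.*2)%N, odd l3, k).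

Lemma shape_coordsP (l1 l2 l3 : nat) (a b : nat) (eps : bool) (k : nat) :
  (l3 <= l2)%N -> (l2 <= l1)%N ->
  shape_coords l1 l2 l3 = (a, b, eps, k) <->
  [/\ (eps <= b)%N, (b <= a)%N, l1 = (a + k.*2)%N, l2 = (b + k.*2)%N
    & l3 = (eps + k.*2)%N].
Proof.
move=> h32 h21; have h3 := odd_double_half l3.
rewrite /shape_coords; split=> [[<- <- <- <-]|[hb ha -> -> ->]].
  by split; lia.
by rewrite half_bit_double oddD odd_double addbF oddb !addnK.
Qed.

Definition omega_shape (lam : seq nat) : rat :=
  let l := nth 0%N (conjp lam) in
  let: (a, b, eps, k) := shape_coords (l 0%N) (l 1%N) (l 2) in
  omegat eps (a - b)%N (b - eps)%N.

(* Main.v *)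
Require Import Defs.
From mathcomp Require Import all_boot all_order all_algebra.
From mathcomp Require Import mpoly.
From mathcomp Require Import zify ring.
Import GRing.Theory.
Local Open Scope ring_scope.

(** The first equality is the expansion of the product: since
    (1 + x)(1 - x^2) = 1 + x - x^2 - x^3, choosing an exponent e_i in {0,1,2,3}
    for each variable gives the monomial x^e with sign (-1)^#{i : e_i >= 2},
    and for a rearrangement e of lambda this number of indices is the second
    column length of lambda.  Grouping the exponent vectors by their column
    lengths #{i : e_i > j} gives the monomial symmetric polynomials
    ([prod_monomial_sym]).

    For the second equality, write
    (1 + x)(1 - x^2) = prod_j (1 + y_j x) with y = (1, 1, -1).  By the dual
    Cauchy identity the coefficient of the Schur polynomial of lambda is the
    Schur polynomial of lambda' at y, and the function omegat is a formula for
    this value.  Only one property of these values is used: the Pieri rule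
      sum_d f(l + d) x^|d| = f(l) g(x),
    where l is a sequence of column lengths, d runs over the 0-1 vectors such
    that l + d is still decreasing, and g(x) = (1 + x)(1 - x^2).  For omegat
    it amounts to the values 1, -1, -1 of the elementary symmetric
    polynomials at y, and is a finite parity computation
    ([omegat_e1], [omegat_e2], [omegat_negb], [omega_heights_pieri]).

    Any f with this Pieri rule, for any number c of columns, satisfies
      sum_lambda f(lambda') s_lambda(x_1, .., x_m) = f(0) prod_i g(x_i)
    ([schur_sum_pieri]).  The sum over lambda and over tableaux of shape
    lambda is a sum over all tableaux with at most c columns and entries below
    m.  Erasing the entries equal to the largest allowed value k leaves a
    tableau with column lengths l, and the erased cells are the bottom cells
    of some columns, given by a 0-1 vector d with l + d decreasing; so the
    Pieri rule sums each fibre of this erasure, and induction on k produces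
    one factor g(x_k) at a time ([tableau_sum_pieri]).

    To avoid handling a family of shapes, a tableau is stored as a filling of
    the whole m x c rectangle, where the cells outside the shape contain m.
    This value plays the role of infinity: the shape, its column lengths, the
    erasure of the entries k and its inverse are all read off the filling. *)

Set Implicit Arguments.
Unset Strict Implicit.
Unset Printing Implicit Defensive.

(** * Column lengths of partitions *)

Lemma card_ord_lt (n k : nat) : (k <= n)%N -> #|[pred i : 'I_n | (i < k)%N]| = k.
Proof.
move=> le_kn; rewrite -sum1_card -[RHS]card_ord -sum1_card.
by rewrite (big_ord_widen n (fun=> 1%N)).
Qed.

(** A downward closed subset of {0, .., n-1} is an initial segment, hence is
    determined by its size: rows and columns of a shape can be recovered from
    their lengths. *)
Lemma down_closed_card (n : nat) (p : pred 'I_n) :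
  (forall i i' : 'I_n, (i <= i')%N -> p i' -> p i) ->
  forall i : 'I_n, p i = (i < #|p|)%N.
Proof.
move=> p_down i; apply/idP/idP => [pi|].
  rewrite -[X in (X <= _)%N](@card_ord_lt n i.+1) //.
  by apply/subset_leq_card/subsetP => j; rewrite !inE => /p_down; apply.
apply: contraTT => npi; rewrite -leqNgt -[leqRHS](@card_ord_lt n i); last exact: ltnW.
apply/subset_leq_card/subsetP => j; rewrite !inE ltnNge => pj.
by apply: contra npi => /p_down; apply.
Qed.

Lemma part_nth (s : seq nat) (i j : nat) :
  is_part s -> (i <= j)%N -> (nth 0 s j <= nth 0 s i)%N.
Proof.
move=> s_part le_ij; have [ge_s|lt_s] := leqP (size s) j.
  by rewrite [leqLHS]nth_default.
have := @sorted_leq_nth _ geq (fun _ _ _ h1 h2 => leq_trans h2 h1) leqnn 0%N s s_part.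
by apply; rewrite ?inE // (leq_ltn_trans le_ij).
Qed.

Lemma size_parts (n c : nat) (la : n.-tuple 'I_c.+1) : size (parts la) = n.
Proof. by rewrite size_map size_tuple. Qed.

Lemma nth_parts (n c : nat) (la : n.-tuple 'I_c.+1) (i : 'I_n) :
  nth 0%N (parts la) i = tnth la i.
Proof. by rewrite (nth_map ord0) ?size_tuple // -tnth_nth. Qed.

Lemma nth_parts_leq (n c : nat) (la : n.-tuple 'I_c.+1) (i : nat) :
  (nth 0%N (parts la) i <= c)%N.
Proof.
have [ge_n|lt_n] := leqP n i; first by rewrite nth_default ?size_parts.
by rewrite -[i]/(val (Ordinal lt_n)) nth_parts -ltnS.
Qed.

Lemma nth_conjp (s : seq nat) (j : nat) :
  nth 0%N (conjp s) j = count (fun p => (j < p)%N) s.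
Proof.
rewrite /conjp; set M := (\max_(p <- s) p)%N.
have [lt_M|ge_M] := ltnP j M.
  by rewrite (nth_map 0%N) ?size_iota // nth_iota.
rewrite nth_default ?size_map ?size_iota //; apply/esym/eqP.
rewrite -leqn0 leqNgt -has_count; apply/hasPn => p p_s.
by rewrite -leqNgt (leq_trans _ ge_M) // (@leq_bigmax_seq _ s xpredT id).
Qed.

Lemma count_parts (n c : nat) (la : n.-tuple 'I_c.+1) (j : nat) :
  count (fun p => (j < p)%N) (parts la) = #|[pred i : 'I_n | (j < nth 0 (parts la) i)%N]|.
Proof.
rewrite -sum1_count big_map big_tuple -sum1_card.
by apply: eq_bigl => i; rewrite !inE nth_parts.
Qed.

(** Both sides say that the cell in row j and column i lies in the diagram of s. *)
Lemma count_gt_part (s : seq nat) (i j : nat) :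
  is_part s -> (j < count (fun p => (i < p)%N) s)%N = (i < nth 0 s j)%N.
Proof.
elim: s j => [|p s IH] j; first by rewrite nth_nil.
move=> p_part; have s_part : is_part s := path_sorted p_part.
rewrite [count _ _]/=; case: (ltnP i p) => [lt_p|ge_p].
  by case: j => [|j] /=; [rewrite lt_p | apply: IH].
have -> : count (fun p => (i < p)%N) s = 0%N.
  apply/eqP; rewrite -leqn0 leqNgt -has_count; apply/hasPn => q q_s.
  rewrite -leqNgt (leq_trans _ ge_p) // -(nth_index 0%N q_s).
  exact: (@part_nth (p :: s) 0 (index q s).+1).
apply/esym/negbTE; rewrite -leqNgt (leq_trans _ ge_p) //.
exact: (@part_nth (p :: s) 0 j).
Qed.

Lemma count_mkseq (T : Type) (p : pred T) (f : nat -> T) (m : nat) :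
  count p (mkseq f m) = #|[pred i : 'I_m | p (f i)]|.
Proof.
rewrite count_map -sum1_count -val_enum_ord big_map big_enum_cond -sum1_card.
by apply: eq_bigl => i; rewrite inE.
Qed.

(** * Tableaux as fillings of a rectangle *)

Section Fillings.
Variables m c : nat.
Implicit Types (i : 'I_m) (j : 'I_c) (l : {ffun 'I_c -> nat}) (d : {ffun 'I_c -> bool}).

Definition filling := {ffun 'I_m * 'I_c -> 'I_m.+1}.
Implicit Type t : filling.

Definition row_weak t : bool :=
  [forall i : 'I_m, forall j : 'I_c, forall j' : 'I_c,
     (j <= j')%N ==> (t (i, j) <= t (i, j'))%N].

(** The escape clause is needed since the cells outside the shape all contain m;
    it also forces everything below such a cell to contain m. *)
Definition col_strict t : bool :=
  [forall j : 'I_c, forall i : 'I_m, forall i' : 'I_m, (i < i')%N ==>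
     ((t (i, j) < t (i', j))%N || (t (i', j) == m :> nat))].

Definition tableau t : bool := row_weak t && col_strict t.

Definition height t : {ffun 'I_c -> nat} :=
  [ffun j : 'I_c => #|[pred i : 'I_m | (t (i, j) < m)%N]|].

Definition decreasing l : bool :=
  [forall j : 'I_c, forall j' : 'I_c, (j <= j')%N ==> (l j' <= l j)%N].

(** The cells outside the shape, which contain m, are exempt from the bound. *)
Definition below (k : nat) t : bool :=
  [forall p : 'I_m * 'I_c, (t p < k)%N || (t p == m :> nat)].

Definition add_strip l d : {ffun 'I_c -> nat} := [ffun j : 'I_c => (l j + d j)%N].

Lemma row_weakP t :
  reflect (forall i j j', (j <= j')%N -> (t (i, j) <= t (i, j'))%N) (row_weak t).
Proof.
apply: (iffP forallP) => [h i j j' jj'|h i].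
  by move/forallP: (h i) => /(_ j) /forallP /(_ j') /implyP; apply.
by apply/forallP => j; apply/forallP => j'; apply/implyP; apply: h.
Qed.

Lemma col_strictP t :
  reflect (forall i i' j, (i < i')%N -> (t (i', j) < m)%N -> (t (i, j) < t (i', j))%N)
    (col_strict t).
Proof.
apply: (iffP forallP) => [h i i' j ii' lt_m|h j].
  move/forallP: (h j) => /(_ i) /forallP /(_ i') /implyP /(_ ii') /orP [] //.
  by move/eqP; lia.
apply/forallP => i; apply/forallP => i'; apply/implyP => ii'.
have := ltn_ord (t (i', j)); rewrite ltnS leq_eqVlt => /orP [->|]; first by rewrite orbT.
by move/(h _ _ _ ii') ->.
Qed.

Lemma decreasingP l :
  reflect (forall j j', (j <= j')%N -> (l j' <= l j)%N) (decreasing l).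
Proof.
apply: (iffP forallP) => [h j j' jj'|h j].
  by move/forallP: (h j) => /(_ j') /implyP; apply.
by apply/forallP => j'; apply/implyP; apply: h.
Qed.

Lemma below_neq k t : (k < m)%N -> below k t -> forall p, t p != k :> nat.
Proof. by move=> km /forallP h p; have := h p; lia. Qed.

Lemma heightE t i j : col_strict t -> (t (i, j) < m)%N = (i < height t j)%N.
Proof.
move=> /col_strictP h; rewrite ffunE.
apply: (down_closed_card (p := [pred i : 'I_m | (t (i, j) < m)%N])) => i1 i2 /=.
rewrite leq_eqVlt => /orP [/eqP/val_inj -> //|lt_i] lt_m.
exact: ltn_trans (h _ _ _ lt_i lt_m) lt_m.
Qed.

Lemma leq_height t j : (height t j <= m)%N.
Proof. by rewrite ffunE (leq_trans (max_card _)) // card_ord. Qed.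

(** This bounds the column lengths by the number of available entries, so that a
    column has room for one more entry in the rectangle ([height_below]). *)
Lemma col_strict_ge t i j : col_strict t -> (i <= t (i, j))%N.
Proof.
move=> /col_strictP h; case: i => i; elim: i => // i IH lt_im.
have [ge_m|lt_m] := leqP m (t (Ordinal lt_im, j)); first exact: leq_trans (ltnW lt_im) ge_m.
apply: leq_trans (h (Ordinal (ltnW lt_im)) _ _ _ lt_m) => //=.
by rewrite ltnS; apply: IH.
Qed.

Lemma height_below k t j : (k <= m)%N -> col_strict t -> below k t -> (height t j <= k)%N.
Proof.
move=> le_km ts /forallP tb; rewrite leqNgt; apply/negP => lt_k.
have lt_km : (k < m)%N := leq_trans lt_k (leq_height t j).
have := tb (Ordinal lt_km, j); have := col_strict_ge (Ordinal lt_km) j ts.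
have : (Ordinal lt_km < height t j)%N by [].
rewrite -heightE //=; lia.
Qed.

Lemma decreasing_height t : tableau t -> decreasing (height t).
Proof.
case/andP => /row_weakP tr ts; apply/decreasingP => j j' jj'.
rewrite leqNgt; apply/negP => lt_h.
have lt_m := leq_trans lt_h (leq_height t j').
have : (Ordinal lt_m < height t j')%N by [].
rewrite -heightE // => /(leq_ltn_trans (tr _ _ _ jj')).
by rewrite heightE //= ltnn.
Qed.

Definition truncate (k : nat) t : filling :=
  [ffun p : 'I_m * 'I_c => if (t p < k)%N then t p else ord_max].

Definition extend (k : nat) t d : filling :=
  [ffun p : 'I_m * 'I_c => if d p.2 && (p.1 == height t p.2 :> nat) then inord k else t p].

Definition strip (k : nat) t : {ffun 'I_c -> bool} :=
  [ffun j : 'I_c => [exists i : 'I_m, t (i, j) == k :> nat]].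

Section Step.
Variable k : nat.
Hypothesis lt_km : (k < m)%N.


Lemma truncate_tableau t : tableau t -> tableau (truncate k t) && below k (truncate k t).
Proof.
case/andP => /row_weakP tr /col_strictP ts; apply/andP; split; first (apply/andP; split).
- apply/row_weakP => i j j' /(tr i); rewrite !ffunE.
  by case: ifP => h1; case: ifP => h2 //= h3; lia.
- apply/col_strictP => i i' j /(ts i i' j); rewrite !ffunE.
  by case: (ltnP (t (i', j)) k) => h2; case: ifP => h1 //= h3; lia.
- by apply/forallP => p; rewrite !ffunE; case: ifP => [->//|_]; rewrite /= eqxx orbT.
Qed.

Section Fibre.
Variable t : filling.
Hypotheses (t_tab : tableau t) (t_below : below k t).

Let tr : row_weak t := proj1 (andP t_tab).
Let ts : col_strict t := proj2 (andP t_tab).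

Let top_row j : 'I_m :=
  Ordinal (leq_ltn_trans (height_below j (ltnW lt_km) ts t_below) lt_km).

Let t_top j : t (top_row j, j) = m :> nat.
Proof.
apply/eqP; rewrite eqn_leq -ltnS ltn_ord /= leqNgt heightE //=; lia.
Qed.

Lemma extendE d i j : 
  extend k t d (i, j) = (if d j && (i == height t j :> nat) then k else t (i, j)) :> nat.
Proof.
by rewrite ffunE /=; case: ifP => // _; apply: inordK (leqW lt_km).
Qed.

(** Adding k at the bottom of the columns selected by d creates the shape with
    column lengths increased by d. *)
Lemma extend_lt d i j : (extend k t d (i, j) < m)%N = (i < height t j + d j)%N.
Proof.
rewrite extendE; have := heightE i j ts.
by case: (d j) => /=; last lia; case: eqP; lia.
Qed.

Lemma height_extend d : height (extend k t d) = add_strip (height t) d.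
Proof.
apply/ffunP => j; rewrite [LHS]ffunE [RHS]ffunE.
rewrite -[RHS](@card_ord_lt m).
  by apply: eq_card => i; rewrite !inE extend_lt.
have := height_below j (ltnW lt_km) ts t_below; case: (d j) => /=; lia.
Qed.

Lemma strip_extend d : strip k (extend k t d) = d.
Proof.
apply/ffunP => j; rewrite ffunE; apply/existsP/idP => [[i]|dj].
  rewrite extendE; case: (d j) => //=.
  by have := below_neq lt_km t_below (i, j) => /negbTE ->.
by exists (top_row j); rewrite extendE dj /= !eqxx.
Qed.

Lemma truncate_extend d : truncate k (extend k t d) = t.
Proof.
apply/ffunP => -[i j]; apply/val_inj; rewrite ffunE.
rewrite [LHS](fun_if val) /= extendE.
case: (boolP (d j && (i == height t j :> nat))) => [/andP [_ /eqP ij]|_]; last first.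
  by have := forallP t_below (i, j); case: ifP => //= _ /eqP.
have -> : i = top_row j by apply: val_inj.
by rewrite ltnn t_top.
Qed.

Lemma below_extend d : below k.+1 (extend k t d).
Proof.
apply/forallP => -[i j]; rewrite extendE.
by have := forallP t_below (i, j); case: ifP => _ /=; lia.
Qed.

Lemma col_strict_extend d : col_strict (extend k t d).
Proof.
apply/col_strictP => i i' j ii' lt_m.
have := extend_lt d i' j; rewrite lt_m => /esym; move: lt_m.
have := heightE i j ts; have := heightE i' j ts; rewrite !extendE.
have := forallP t_below (i, j); have := col_strictP _ ts i i' j ii'.
case: (d j) => /=; last lia.
by case: (boolP (i == height t j :> nat)) => h1;
  case: (boolP (i' == height t j :> nat)) => h2; lia.
Qed.

(** As k exceeds all other entries, the rows stay weakly increasing exactly when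
    the enlarged shape is that of a partition. *)
Lemma tableau_extend d : tableau (extend k t d) = decreasing (add_strip (height t) d).
Proof.
apply/idP/idP => [/decreasing_height|]; first by rewrite height_extend.
move=> /decreasingP dec; rewrite /tableau col_strict_extend andbT.
apply/row_weakP => i j j' jj'; have := dec _ _ jj'; have := row_weakP _ tr i _ _ jj'.
rewrite [add_strip _ _ _]ffunE [add_strip _ _ j]ffunE.
have := extend_lt d i j; have := extend_lt d i j'; rewrite !extendE.
have := heightE i j ts; have := heightE i j' ts.
have := forallP t_below (i, j); have := forallP t_below (i, j').
case: (d j); case: (d j') => /=;
  case: (boolP (i == height t j :> nat)) => h1;
  case: (boolP (i == height t j' :> nat)) => h2; lia.
Qed.

(** In each column of t1 the entry k can only be the last one, so the columns
    that contain k determine t1 from its truncation. *)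
Lemma extend_strip t1 : tableau t1 -> below k.+1 t1 -> truncate k t1 = t ->
  extend k t (strip k t1) = t1.
Proof.
case/andP => _ /[dup] ts1 /col_strictP h1 b1 tr1.
apply/ffunP => -[i j]; apply/val_inj; rewrite /= extendE.
have tE i0 j0 : t (i0, j0) = (if (t1 (i0, j0) < k)%N then t1 (i0, j0) : nat else m) :> nat.
  by rewrite -tr1 ffunE; case: ifP.
(* Column strictness puts an entry k right below the entries smaller than k. *)
have hE i0 j0 : t1 (i0, j0) = k :> nat -> height t j0 = i0.
  move=> E; rewrite ffunE -[RHS](@card_ord_lt m); last exact: ltnW.
  apply: eq_card => i1; rewrite !inE tE.
  have := h1 i1 i0 j0; have := h1 i0 i1 j0; have := ltn_ord (t1 (i1, j0)).
  case: (ltngtP i0 i1) => [||/val_inj <-]; try case: ifP; lia.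
rewrite ffunE; case: (boolP [exists _, _]) => [/existsP [i0 /eqP E]|] /=.
  rewrite (hE _ _ E); case: eqP => [/val_inj -> //|ne].
  rewrite tE; case: ltnP => // ge_k.
  have : t1 (i, j) != k :> nat by apply/eqP => /hE E'; rewrite -(hE _ _ E) -E' in ne.
  case/orP: (forallP b1 (i, j)) => [|/eqP ->//]; rewrite ltnS => le_k.
  by rewrite eqn_leq le_k ge_k.
rewrite negb_exists => /forallP /(_ i); rewrite tE.
case: ltnP => // ge_k ne.
case/orP: (forallP b1 (i, j)) => [|/eqP ->//]; rewrite ltnS => le_k.
by rewrite eqn_leq le_k ge_k in ne.
Qed.

Lemma prod_extend (S : comNzRingType) (w : nat -> S) d : w m = 1 ->
  \prod_p w (extend k t d p) = (\prod_p w (t p)) * w k ^+ (\sum_j d j)%N.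
Proof.
move=> wm.
have E (F : 'I_m * 'I_c -> S) : \prod_p F p = \prod_j \prod_i F (i, j).
  by rewrite exchange_big pair_bigA /=; apply: eq_bigr => -[].
rewrite !E expr_sum -big_split /=; apply: eq_bigr => j _.
rewrite (bigD1 (top_row j)) //= [in RHS](bigD1 (top_row j)) //=.
rewrite extendE eqxx t_top wm mul1r andbT.
rewrite mulrC; congr (_ * _); last by case: (d j).
apply: eq_bigr => i ne; rewrite extendE; case: ifP => // /andP [_ /eqP ij].
by case/eqP: ne; apply: val_inj.
Qed.

End Fibre.
End Step.
End Fillings.

(** The branching rule in summed form.  The fibre of [truncate k] over t is the
    set of [extend k t d] with [add_strip (height t) d] decreasing, so the
    Pieri rule for f contributes one factor g (w k) for each k. *)
Lemma tableau_sum_pieri (R : comNzRingType) (S : comAlgType R) (m c : nat)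
    (f : {ffun 'I_c -> nat} -> R) (g : S -> S) (w : nat -> S) :
  (forall l x, decreasing l ->
     \sum_(d : {ffun 'I_c -> bool} | decreasing (add_strip l d))
        f (add_strip l d) *: x ^+ (\sum_j d j)%N = f l *: g x) ->
  w m = 1 ->
  forall k : nat, (k <= m)%N ->
  \sum_(t : filling m c | tableau t && below k t) f (height t) *: \prod_p w (t p)
    = f [ffun=> 0%N] *: \prod_(i < k) g (w i).
Proof.
move=> pieri wm; elim=> [_|k IH lt_km].
  (* Without available entries only the empty tableau remains. *)
  rewrite (big_pred1 [ffun=> ord_max]) => [|t].
    rewrite big_ord0 big1 => [|p _]; last by rewrite ffunE.
    congr (f _ *: _); apply/ffunP => j; rewrite !ffunE.
    by apply: eq_card0 => i; rewrite !inE ffunE /= ltnn.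
  rewrite /= andbC; apply/andP/eqP => [[/forallP t0 _]|->].
    by apply/ffunP => p; apply/val_inj/eqP; rewrite ffunE; apply: t0.
  split; first by apply/forallP => p; rewrite ffunE /= eqxx.
  apply/andP; split; first by apply/row_weakP => i j j' _; rewrite !ffunE.
  by apply/col_strictP => i i' j _; rewrite !ffunE /= ltnn.
rewrite (partition_big (@truncate m c k) (fun t => tableau t && below k t)) /=; last first.
  by move=> t /andP [t_tab _]; apply: truncate_tableau.
rewrite big_ord_recr /= scalerAl -IH; last exact: ltnW.
rewrite mulr_suml; apply: eq_bigr => t /andP [t_tab t_below].
rewrite (reindex_onto (extend k t) (@strip m c k)) /=; last first.
  by move=> t1 /andP [/andP [t1_tab t1_below] /eqP]; apply: extend_strip.
rewrite -scalerAl scalerAr.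
rewrite -(pieri _ _ (decreasing_height t_tab)) mulr_sumr.
apply: eq_big => [d|d _].
  rewrite tableau_extend // below_extend // truncate_extend // strip_extend //.
  by rewrite !eqxx !andbT.
by rewrite height_extend // prod_extend // scalerAr.
Qed.

(** * Schur polynomials as sums over fillings *)

Lemma is_ssytP (n : nat) (lam : seq nat) (T : {ffun cell lam -> 'I_n}) :
  reflect
    (forall u v : cell lam,
       (cell_row u = cell_row v -> (cell_col u < cell_col v)%N -> (T u <= T v)%N) /\
       (cell_col u = cell_col v -> (cell_row u < cell_row v)%N -> (T u < T v)%N))
    (is_ssyt T).
Proof.
apply: (iffP forallP) => [h u v|h u].
  have /forallP /(_ v) /andP [/implyP h1 /implyP h2] := h u.
  by split=> /eqP e lt_uv; [apply: h1 | apply: h2]; rewrite e.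
apply/forallP => v; have [h1 h2] := h u v.
by apply/andP; split; apply/implyP => /andP [/eqP]; [apply: h1 | apply: h2].
Qed.

Definition row_shape (m c : nat) (t : filling m c) : m.-tuple 'I_c.+1 :=
  [tuple inord #|[pred j : 'I_c | (t (i, j) < m)%N]| | i < m].

(** The weight of an entry: the marker m of the cells outside the shape counts
    as 1, so that the weight of a filling is a product over the rectangle. *)
Definition entry_var (R : nzRingType) (m k : nat) : {mpoly R[m]} :=
  oapp (fun i : 'I_m => 'X_i) 1 (insub k).

Section SchurFilling.
Variables (m c : nat) (la : m.-tuple 'I_c.+1).
Hypothesis la_part : la \in box m c.
Local Notation lam := (parts la).
Implicit Types (u v : cell lam) (t : filling m c) (T : {ffun cell lam -> 'I_m}).

Let lam_part : is_part lam. Proof. by move: la_part; rewrite inE. Qed.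

Lemma row_shapeP t : row_weak t ->
  reflect (forall i j, (t (i, j) < m)%N = (j < nth 0 lam i)%N) (row_shape t == la).
Proof.
move=> /row_weakP tr; have cnt i j :
    (t (i, j) < m)%N = (j < #|[pred j : 'I_c | (t (i, j) < m)%N]|)%N.
  apply: (down_closed_card (p := [pred j : 'I_c | (t (i, j) < m)%N])) => j1 j2 /= le_j.
  exact/leq_ltn_trans/tr.
apply: (iffP eqP) => [<- i j|h].
  rewrite nth_parts tnth_mktuple inordK; first exact: cnt.
  by rewrite ltnS (leq_trans (max_card _)) ?card_ord.
apply: eq_from_tnth => i; apply: val_inj; rewrite tnth_mktuple /= -nth_parts.
have le_c := nth_parts_leq la i.
rewrite (eq_card (B := [pred j : 'I_c | (j < nth 0 lam i)%N])).
  by rewrite card_ord_lt // inordK.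
by move=> j; rewrite !inE h.
Qed.

Lemma cell_row_lt u : (cell_row u < m)%N.
Proof. by rewrite -[ltnRHS](size_parts la) /cell_row ltn_ord. Qed.

Lemma cell_col_lt u : (cell_col u < c)%N.
Proof. exact: leq_trans (ltn_ord _) (nth_parts_leq _ _). Qed.

Definition cell_pos u : 'I_m * 'I_c := (Ordinal (cell_row_lt u), Ordinal (cell_col_lt u)).

Lemma cell_pos_inj : injective cell_pos.
Proof.
move=> [i j] [i' j'] [e1 e2].
have ii' : i = i' by apply: val_inj.
by clear e1; subst i'; congr existT; apply: val_inj.
Qed.

Lemma cell_pos_in u : ((cell_pos u).2 < nth 0 lam (cell_pos u).1)%N.
Proof. exact: (ltn_ord (tagged u)). Qed.

Lemma cell_posP (p : 'I_m * 'I_c) : (p.2 < nth 0 lam p.1)%N -> {u | cell_pos u = p}.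
Proof.
case: p => i j /= lt_j; have lt_i : (i < size lam)%N by rewrite size_parts.
exists (Tagged (fun i : 'I_(size lam) => 'I_(nth 0%N lam i))
          (i := Ordinal lt_i) (Ordinal lt_j)).
by congr (_, _); apply: val_inj.
Qed.

Definition fill_of T : filling m c :=
  [ffun p => oapp (fun u => widen_ord (leqnSn m) (T u)) ord_max [pick u | cell_pos u == p]].

(** The row index of the cell serves as default value of [insubd], since 'I_m
    may be empty. *)
Definition entries_of t : {ffun cell lam -> 'I_m} :=
  [ffun u => insubd (cell_pos u).1 (t (cell_pos u) : nat)].

Lemma fill_of_cell T u : fill_of T (cell_pos u) = T u :> nat.
Proof.
rewrite ffunE; case: pickP => [v /eqP /cell_pos_inj -> //|/(_ u)].
by rewrite eqxx.
Qed.

Lemma fill_of_out T (p : 'I_m * 'I_c) : ~~ (p.2 < nth 0 lam p.1)%N -> fill_of T p = m :> nat.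
Proof.
move=> out; rewrite ffunE; case: pickP => //= u /eqP e.
by move: out; rewrite -e cell_pos_in.
Qed.

Lemma fill_of_lt T (p : 'I_m * 'I_c) : (fill_of T p < m)%N = (p.2 < nth 0 lam p.1)%N.
Proof.
case: (boolP (p.2 < _)%N) => [/cell_posP [u <-]|/(fill_of_out T) ->].
  by rewrite fill_of_cell ltn_ord.
by rewrite ltnn.
Qed.

Lemma fill_ofK : cancel fill_of entries_of.
Proof.
move=> T; apply/ffunP => u; apply/val_inj.
by rewrite ffunE val_insubd fill_of_cell ltn_ord.
Qed.

Lemma entries_ofK t :
  (forall i j, (t (i, j) < m)%N = (j < nth 0 lam i)%N) -> fill_of (entries_of t) = t.
Proof.
move=> h; apply/ffunP => -[i j]; apply/val_inj => /=.
case: (boolP (j < nth 0 lam i)%N) => [in_j|out_j].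
  have [u <-] := @cell_posP (i, j) in_j; rewrite fill_of_cell ffunE val_insubd.
  by rewrite /cell_pos h cell_pos_in.
rewrite fill_of_out //; apply/eqP; rewrite eqn_leq -[_ && _]andbC -ltnS ltn_ord /=.
by rewrite leqNgt h.
Qed.

Lemma tableau_fill_of T : tableau (fill_of T) = is_ssyt T.
Proof.
apply/andP/is_ssytP => [[/row_weakP tr /col_strictP ts] u v|ssyt].
  rewrite -!(fill_of_cell T) [cell_pos u]surjective_pairing [cell_pos v]surjective_pairing.
  split=> e lt_uv.
    have -> : (cell_pos u).1 = (cell_pos v).1 by apply: val_inj.
    exact/tr/ltnW.
  have -> : (cell_pos u).2 = (cell_pos v).2 by apply: val_inj.
  by apply: ts => //; rewrite fill_of_lt cell_pos_in.
split.
  apply/row_weakP => i j j'; rewrite leq_eqVlt => /orP [/eqP/val_inj -> //|lt_j].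
  case: (boolP (j' < nth 0 lam i)%N) => [in_j'|out_j]; last first.
    by rewrite [leqRHS]fill_of_out // -ltnS.
  have [v ev] := @cell_posP (i, j') in_j'.
  have [u eu] := @cell_posP (i, j) (ltn_trans lt_j in_j').
  have [h _] := ssyt u v.
  rewrite -eu -ev !fill_of_cell; apply: h.
    by change ((cell_pos u).1 = (cell_pos v).1 :> nat); rewrite eu ev.
  by change ((cell_pos u).2 < (cell_pos v).2)%N; rewrite eu ev.
apply/col_strictP => i i' j lt_i; rewrite fill_of_lt /= => in_j.
have [v ev] := @cell_posP (i', j) in_j.
have [u eu] := @cell_posP (i, j) (leq_trans in_j (part_nth lam_part (ltnW lt_i))).
have [_ h] := ssyt u v.
rewrite -eu -ev !fill_of_cell; apply: h.
  by change ((cell_pos u).2 = (cell_pos v).2 :> nat); rewrite eu ev.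
by change ((cell_pos u).1 < (cell_pos v).1)%N; rewrite eu ev.
Qed.

Lemma schur_filling (R : comNzRingType) :
  schur R m lam =
    \sum_(t : filling m c | tableau t && (row_shape t == la))
      \prod_p entry_var R m (t p).
Proof.
rewrite [RHS](reindex_onto fill_of entries_of) /=; last first.
  move=> t /andP [/andP [tr _] /(row_shapeP tr)]; exact: entries_ofK.
apply: eq_big => [T|T _].
  rewrite fill_ofK eqxx andbT tableau_fill_of; case: (boolP (is_ssyt T)) => //=.
  rewrite -tableau_fill_of => /andP [tr _]; apply/esym/row_shapeP => // i j.
  exact: fill_of_lt.
rewrite [RHS](bigID (mem [set cell_pos u | u : cell lam])) /=.
rewrite big_imset => [|u v _ _]; last exact: cell_pos_inj.
rewrite [X in _ * X]big1 ?mulr1 => [|p out_p].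
  by apply: eq_bigr => u _; rewrite fill_of_cell /entry_var valK.
rewrite /entry_var fill_of_out ?insubN ?ltnn //.
by apply: contra out_p => /cell_posP [u <-]; apply: imset_f.
Qed.

End SchurFilling.

(** The pairs of a shape la in the m x c box and a tableau of shape la are the
    fillings, and f is evaluated at the column lengths of the filling, so the
    left side is a sum over all fillings. *)
Lemma schur_sum_pieri (R : comNzRingType) (m c : nat)
    (f : {ffun 'I_c -> nat} -> R) (g : {mpoly R[m]} -> {mpoly R[m]}) :
  (forall l x, decreasing l ->
     \sum_(d : {ffun 'I_c -> bool} | decreasing (add_strip l d))
        f (add_strip l d) *: x ^+ (\sum_j d j)%N = f l *: g x) ->
  \sum_(la in box m c)
      f [ffun j : 'I_c => nth 0%N (conjp (parts la)) j] *: schur R m (parts la)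
    = f [ffun=> 0%N] *: \prod_(i < m) g 'X_i.
Proof.
move=> pieri; have var_m : entry_var R m m = 1 by rewrite /entry_var insubN ?ltnn.
have := tableau_sum_pieri pieri var_m (leqnn m).
have -> : \prod_(i < m) g (entry_var R m i) = \prod_(i < m) g 'X_i.
  by apply: eq_bigr => i _; rewrite /entry_var valK.
move<-; rewrite [RHS](partition_big (@row_shape m c) (fun la => la \in box m c)) /=.
  apply: eq_bigr => la la_box; rewrite schur_filling // scaler_sumr.
  apply: eq_big => [t|t /andP [/andP [tr ts] /(row_shapeP la tr) h]].
    congr (_ && _); rewrite andb_idr // => _; apply/forallP => p.
    by rewrite orbC -leq_eqVlt -ltnS.
  congr (f _ *: _); apply/ffunP => j; rewrite !ffunE nth_conjp count_parts.
  by apply: eq_card => i; rewrite !inE h.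
move=> t /andP [/andP [/row_weakP tr ts] _]; rewrite inE /is_part.
apply/(sortedP 0%N) => i; rewrite size_parts => lt_i1.
pose i0 := Ordinal (ltnW lt_i1); pose i1 := Ordinal lt_i1.
rewrite -[i]/(val i0) -[i.+1]/(val i1) !nth_parts !tnth_mktuple.
rewrite !inordK ?ltnS; last 2 first.
- by rewrite (leq_trans (max_card _)) ?card_ord.
- by rewrite (leq_trans (max_card _)) ?card_ord.
apply/subset_leq_card/subsetP => j; rewrite !inE !heightE //.
exact: ltn_trans.
Qed.

(** * The Pieri rule for the coefficients *)

(** Subtracting 2k from all column lengths changes neither their differences z
    and b' nor the parity eps of the last one, so k can be eliminated. *)
Definition omega_heights (l : {ffun 'I_3 -> nat}) : rat :=
  omegat (odd (l (inord 2))) (l (inord 0) - l (inord 1)) (l (inord 1) - l (inord 2)).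

Lemma omega_shape_heights (la : seq nat) :
  omega_shape la = omega_heights [ffun j : 'I_3 => nth 0%N (conjp la) j].
Proof.
rewrite /omega_shape /omega_heights !ffunE !inordK // !nth_conjp.
set l0 := count _ _; set l1 := count _ _; set l2 := count _ _.
have le01 : (l1 <= l0)%N by apply: sub_count => p /=; lia.
have le12 : (l2 <= l1)%N by apply: sub_count => p /=; lia.
by rewrite /shape_coords; have half_l2 := odd_double_half l2; congr omegat; lia.
Qed.

Section OmegaPieri.
Variables (eps : bool) (z b : nat).

(** The three following identities are the Pieri rule for multiplication by the
    third, first and second elementary symmetric polynomials at (1, 1, -1),
    whose values are -1, 1, -1.  The parameters of omegat are the differences z
    and b of consecutive column lengths; a term is dropped when its shape would
    have a negative difference. *)
Lemma omegat_negb : omegat (~~ eps) z b = - omegat eps z b.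
Proof.
rewrite /omegat -mulNr -rmorphN; congr (_%:~R / _).
by rewrite /dot /alpha /betat; case: eps; case: (odd z); case: (odd b) => /=; lia.
Qed.

Lemma omegat_e1 :
  omegat eps z.+1 b + (if (0 < z)%N then omegat eps z.-1 b.+1 else 0)
    + (if (0 < b)%N then omegat (~~ eps) z b.-1 else 0) = omegat eps z b.
Proof.
case: z b => [|z'] [|b']; rewrite /= ?addr0 /omegat -?mulrDl -?rmorphD;
  congr (_%:~R / _); rewrite /dot /alpha /betat /= ?negbK;
  case: eps; try case: (odd z'); try case: (odd b'); rewrite /=; lia.
Qed.

Lemma omegat_e2 :
  omegat eps z b.+1 + (if (0 < b)%N then omegat (~~ eps) z.+1 b.-1 else 0)
    + (if (0 < z)%N then omegat (~~ eps) z.-1 b else 0) = - omegat eps z b.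
Proof.
case: z b => [|z'] [|b']; rewrite /= ?addr0 /omegat -?mulNr -?mulrDl -?rmorphD -?rmorphN;
  congr (_%:~R / _); rewrite /dot /alpha /betat /= ?negbK;
  case: eps; try case: (odd z'); try case: (odd b'); rewrite /=; lia.
Qed.
End OmegaPieri.

Section Strips3.
Variable l : {ffun 'I_3 -> nat}.

(** Coordinates on the 0-1 vectors, to write a sum over them as eight terms. *)
Definition strip3 (d : bool * bool * bool) : {ffun 'I_3 -> bool} :=
  [ffun j : 'I_3 => nth false [:: d.1.1; d.1.2; d.2] j].

Lemma decreasing3 :
  decreasing l = (l (inord 1) <= l (inord 0))%N && (l (inord 2) <= l (inord 1))%N.
Proof.
apply/decreasingP/andP => [h|[h01 h12] j j'].
  by split; apply: h; rewrite !inordK.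
rewrite -[j]inord_val -[j']inord_val.
case: j j' => [[|[|[|]]]//] ? [[|[|[|]]]//] ? /=; rewrite !inordK //; lia.
Qed.

Lemma big_strip3 (V : nmodType) (F : {ffun 'I_3 -> bool} -> V) :
  \sum_d F d = \sum_a \sum_b \sum_c F (strip3 (a, b, c)).
Proof.
rewrite (reindex_onto strip3 (fun d => (d (inord 0), d (inord 1), d (inord 2)))) /=.
  rewrite (eq_bigl xpredT) => [|[[a b] c]]; last by rewrite !ffunE !inordK //= eqxx.
  rewrite (pair_bigA _ (fun a b => \sum_c F (strip3 (a, b, c)))) /=.
  rewrite (pair_bigA _ (fun ab c => F (strip3 (ab.1, ab.2, c)))) /=.
  by apply: eq_bigr => -[[a b] c].
move=> d _; apply/ffunP => j; rewrite ffunE -[in RHS](inord_val j).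
by case: j => [[|[|[|]]]//].
Qed.
End Strips3.

(** Among the eight vectors d, those of weight 1, 2 and 3 give the coefficients
    of x, x^2 and x^3, to be compared with 1 + x - x^2 - x^3. *)
Lemma omega_heights_pieri (S : comAlgType rat) (l : {ffun 'I_3 -> nat}) (x : S) :
  decreasing l ->
  \sum_(d : {ffun 'I_3 -> bool} | decreasing (add_strip l d))
      omega_heights (add_strip l d) *: x ^+ (\sum_j d j)%N
    = omega_heights l *: ((1 + x) * (1 - x ^+ 2)).
Proof.
rewrite decreasing3 => /andP [le10 le21].
rewrite big_mkcond big_strip3 !big_bool /=.
have sizeE a b c : (\sum_j strip3 (a, b, c) j = a + (b + c))%N.
  by rewrite !big_ord_recl big_ord0 !ffunE /= addn0.
pose eps := odd (l (inord 2)).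
pose z := (l (inord 0) - l (inord 1))%N; pose b0 := (l (inord 1) - l (inord 2))%N.
(* The two conditions say that the new differences of column lengths are
   nonnegative in the integers. *)
have termE (a b c : bool) :
    (if decreasing (add_strip l (strip3 (a, b, c)))
     then omega_heights (add_strip l (strip3 (a, b, c))) *: x ^+ (\sum_j strip3 (a, b, c) j)
     else 0)
  = (if (b <= z + a)%N && (c <= b0 + b)%N
     then omegat (c (+) eps) (z + a - b) (b0 + b - c) else 0) *: x ^+ (a + (b + c)).
  rewrite sizeE decreasing3 /omega_heights !ffunE !inordK //=.
  set C1 := _ && _; set C2 := _ && _.
  have -> : C1 = C2 by rewrite {}/C1 {}/C2 /z /b0; lia.
  case: (boolP C2) => [/andP [h1 h2]|_]; last by rewrite scale0r.
  rewrite oddD oddb addbC; congr (omegat _ _ _ *: _); rewrite /z /b0; lia.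
rewrite !termE /= !addnS !addn0 !subn0 !subn1 /= !andbT expr0 expr1.
have -> : (1 + x) * (1 - x ^+ 2) = 1 + x - x ^+ 2 - x ^+ 3 by ring.
rewrite !scalerBr scalerDr /omega_heights -/eps -/z -/b0.
have /(congr1 (fun r => r *: x)) := omegat_e1 eps z b0.
have /(congr1 (fun r => r *: x ^+ 2)) := omegat_e2 eps z b0.
rewrite (omegat_negb eps z b0) !scalerDl !scaleNr => E2 E1.
rewrite -[in RHS]E2 -[in RHS]E1; ring.
Qed.

(** * Expansion in monomial symmetric polynomials *)

(** The counts of entries above each j are the parts of the conjugate, so this is
    the fact that a multiset of numbers of given size is determined by its
    conjugate. *)
Lemma perm_eq_count_gt (s t : seq nat) :
  size s = size t ->
  (forall j, count (fun p => (j < p)%N) s = count (fun p => (j < p)%N) t) ->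
  perm_eq s t.
Proof.
have countE (x : nat) (u : seq nat) :
    (count (pred1 x) u + count (fun p => x < p) u = count (fun p => x <= p) u)%N.
  by elim: u => //= p u; rewrite eq_sym; case: ltngtP; lia.
move=> eq_size same_count; apply/allP => x _; apply/eqP.
have : count (fun p => (x <= p)%N) s = count (fun p => (x <= p)%N) t.
  case: x => [|x]; last exact: same_count.
  by rewrite !(@eq_count _ _ predT) ?count_predT.
by have := countE x s; have := countE x t; have := same_count x; lia.
Qed.

(** Conjugation is an involution on partitions, up to padding by zeros. *)
Lemma count_conjp (m : nat) (s : seq nat) (j : nat) :
  is_part s -> (forall i, (nth 0 s i <= m)%N) ->
  count (fun p => (j < p)%N) (mkseq (nth 0%N (conjp s)) m) = nth 0%N s j.
Proof.
move=> s_part s_le; rewrite count_mkseq -[RHS](@card_ord_lt m) //; apply: eq_card => i.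
by rewrite !inE /= nth_conjp count_gt_part.
Qed.

Section MonomialExpansion.
Variables (R : comNzRingType) (m c : nat) (a : nat -> R).
Implicit Types (e : {ffun 'I_m -> 'I_c.+1}) (mu : c.-tuple 'I_m.+1).

Definition exponents e : seq nat := [seq (e i : nat) | i <- enum 'I_m].

(** The column lengths of the partition obtained by sorting e. *)
Definition col_lengths e : c.-tuple 'I_m.+1 :=
  [tuple inord (count (fun p => (j < p)%N) (exponents e)) | j < c].

Lemma size_exponents e : size (exponents e) = m.
Proof. by rewrite size_map size_enum_ord. Qed.

Lemma nth_exponents e (i : 'I_m) : nth 0%N (exponents e) i = e i.
Proof. by rewrite (nth_map i) ?size_enum_ord // nth_ord_enum. Qed.

Lemma exponents_inj : injective exponents.
Proof.
move=> e e' eq_e; apply/ffunP => i; apply: val_inj.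
by rewrite /= -!nth_exponents eq_e.
Qed.

Lemma col_lengthsP e mu :
  reflect (forall j, count (fun p => (j < p)%N) (exponents e) = nth 0%N (parts mu) j)
    (col_lengths e == mu).
Proof.
have lenE (j : 'I_c) :
    tnth (col_lengths e) j = count (fun p => (j < p)%N) (exponents e) :> nat.
  by rewrite tnth_mktuple inordK // ltnS (leq_trans (count_size _ _)) // size_exponents.
apply: (iffP eqP) => [<- j|h].
  have [ge_c|lt_c] := leqP c j; last by rewrite -[j]/(val (Ordinal lt_c)) nth_parts lenE.
  rewrite nth_default ?size_parts //; apply/eqP; rewrite -leqn0 leqNgt -has_count.
  apply/hasPn => _ /mapP [i _ ->]; rewrite -leqNgt (leq_trans _ ge_c) //.
  by rewrite -ltnS.
by apply: eq_from_tnth => j; apply: val_inj; rewrite /= lenE h nth_parts.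
Qed.

Lemma col_lengths_box e : col_lengths e \in box c m.
Proof.
rewrite inE /is_part; apply/(sortedP 0%N) => j _.
have /col_lengthsP h := eqxx (col_lengths e); rewrite -!h.
by apply: sub_count => p /=; apply: ltnW.
Qed.

(** A vector is a rearrangement of the partition with column lengths mu exactly
    when it has mu_j entries above j for every j. *)
Lemma perm_exponents mu : mu \in box c m ->
  perm_eq [seq exponents e | e <- enum [pred e | col_lengths e == mu]]
    (permutations (mkseq (nth 0%N (conjp (parts mu))) m)).
Proof.
rewrite inE => mu_part; set L := mkseq _ m.
have L_count j : count (fun p => (j < p)%N) L = nth 0%N (parts mu) j.
  by apply: count_conjp => // i; apply: nth_parts_leq.
apply: uniq_perm; [|exact: permutations_uniq|move=> s].
  by rewrite map_inj_uniq ?enum_uniq //; apply: exponents_inj.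
rewrite mem_permutations; apply/mapP/idP => [[e]|sL].
  rewrite mem_enum inE => /col_lengthsP h ->.
  by apply: perm_eq_count_gt => [|j]; rewrite ?size_exponents ?size_mkseq // h L_count.
have size_s : size s = m by rewrite (perm_size sL) size_mkseq.
pose e : {ffun 'I_m -> 'I_c.+1} := [ffun i : 'I_m => inord (nth 0%N s i)].
have eE : exponents e = s.
  apply: (@eq_from_nth _ 0%N) => [|i]; first by rewrite size_exponents.
  rewrite size_exponents => lt_i; rewrite -[i]/(val (Ordinal lt_i)) nth_exponents ffunE.
  rewrite inordK //= ltnS; have : nth 0%N s i \in L.
    by rewrite -(perm_mem sL) mem_nth // size_s.
  case/mapP => k _ ->; rewrite nth_conjp.
  by rewrite (leq_trans (count_size _ _)) // size_parts.
exists e; rewrite ?eE // mem_enum inE; apply/col_lengthsP => j.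
by rewrite eE (permP sL) L_count.
Qed.

(** The product of the coefficients a (e i) is invariant under rearrangement of e,
    so it is constant on each class of exponent vectors with given column
    lengths. *)
Lemma prod_monomial_sym :
  \prod_(i < m) \sum_(k < c.+1) a k *: 'X_i ^+ k =
    \sum_(mu in box c m)
      (\prod_(i < m) a (nth 0%N (conjp (parts mu)) i))
        *: monomial_sym R m (conjp (parts mu)).
Proof.
rewrite bigA_distr_bigA /=.
rewrite (partition_big col_lengths (fun mu => mu \in box c m)) /= => [|e _]; last first.
  exact: col_lengths_box.
apply: eq_bigr => mu mu_box; rewrite /monomial_sym ifT; last first.
  rewrite (leq_trans (count_size _ _)) // size_map size_iota.
  apply/bigmax_leqP_seq => _ /mapP [i _ ->] _; rewrite -ltnS; apply: (ltn_ord i).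
rewrite -(perm_big _ (perm_exponents mu_box)) big_map big_enum /= scaler_sumr.
apply: eq_big => [e|e /eqP mu_e]; first by rewrite inE.
have /(_ (exponents e)) := perm_mem (perm_exponents mu_box).
rewrite map_f ?mem_enum ?inE ?mu_e // mem_permutations => /esym perm_e.
have -> : \prod_(i < m) a (nth 0%N (conjp (parts mu)) i) = \prod_(i < m) a (e i).
  rewrite -(big_mkord xpredT (fun i => a (nth 0%N (conjp (parts mu)) i))).
  rewrite /index_iota subn0 -(big_map _ xpredT a) -(perm_big _ perm_e).
  by rewrite big_map big_enum.
rewrite scaler_prod mpolyXE_id; congr (_ *: _).
by apply: eq_bigr => i _; rewrite mnmE nth_exponents.
Qed.

End MonomialExpansion.

Unset Implicit Arguments.

Theorem corollary4p17 (m : nat) (hm : (1 <= m)%N) :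
  let P : {mpoly rat[m]} := \prod_(i < m) ((1 + 'X_i) * (1 - 'X_i ^+ 2)) in
  P = \sum_(mu in box 3 m)
        (-1) ^+ odd (nth 0%N (parts mu) 1) *: monomial_sym rat m (conjp (parts mu))
  /\
  P = \sum_(lam in box m 3) omega_shape (parts lam) *: schur rat m (parts lam).
Proof.
move=> P; split; last first.
  have := schur_sum_pieri (@omega_heights_pieri {mpoly rat[m]}).
  rewrite {2}/omega_heights !ffunE /= => sumE.
  rewrite (eq_bigr _ (fun la _ => congr1 ( *:%R^~ _) (omega_shape_heights _))).
  by rewrite sumE; apply/esym/scale1r.
pose a (k : nat) : rat := if (1 < k)%N then -1 else 1.
have -> : P = \prod_(i < m) \sum_(k < 4) a k *: 'X_i ^+ k.
  apply: eq_bigr => i _; rewrite !big_ord_recr big_ord0 /= /a /= !scale1r !scaleN1r.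
  ring.
rewrite prod_monomial_sym; apply: eq_bigr => mu; rewrite inE => mu_part.
congr (_ *: _); rewrite signr_odd -(@count_conjp m _ 1) //; last exact: nth_parts_leq.
rewrite count_mkseq.
by rewrite -big_mkcond prodr_const.
Qed.
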